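(* Let $X$ be a completely regular space, let $E\subseteq X$ be a subspace which is a hereditarily Baire metrizable separable space, and let $Y$ be a topological space which admits a super sequentially absorbing covering $(Y_n:n\in\omega)$ by completely metrizable spaces $Y_n$. Then $(X,E,Y)$ has the ${\rm K}_1$-extension property, i.e. every map $f\in{\rm K}_1(E,Y)$ can be extended to a map $g\in{\rm K}_1(X,Y)$.
   Context: A countable covering $(Y_n:n\in\omega)$ of a topological space $Y$ is called super sequentially absorbing if for every sequence $(y_n)_{n\in\omega}$ in $Y$ such that $y_n\notin Y_n$ for all $n\in\omega$ the set $\{y_n:n\in\omega\}$ is closed in $Y$. Every such covering is sequentially absorbing (for any convergent sequence $(y_n)_{n\in\omega}$ in $Y$ there exists $k\in\omega$ with $\{y_n:n\in\omega\}\subseteq Y_k$), and by standing assumption every sequentially absorbing covering is closed (each $Y_n$ is closed in $Y$) and increasing ($Y_n\subseteq Y_{n+1}$). A space is hereditarily Baire if each of its closed subspaces is a Baire space. Completely regular spaces are assumed $T_1$. A set is functionally closed if it is the zero set of a continuous real-valued function, and functionally $F_\sigma$ if it is a countable union of functionally closed sets. ${\rm K}_1(X,Y)$ is the set of functionally $F_\sigma$-measurable maps $f:X\to Y$, i.e. such that $f^{-1}(V)$ is a functionally $F_\sigma$-set in $X$ for every open $V\subseteq Y$. *)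

(* Defs.v *)
(* Subspaces are the subtypes [set_type A] (coercion from
   [set T]) with the initial topology, not the library's [subspace A], in which
   the points outside of A are isolated. *)
From HB Require Import structures.
From mathcomp Require Import all_boot all_order all_algebra.
From mathcomp Require Import all_classical all_reals.
From mathcomp Require Import topology normedtype.

Set Implicit Arguments.
Unset Strict Implicit.
Unset Printing Implicit Defensive.

Import Order.TTheory GRing.Theory Num.Theory.
Import numFieldNormedType.Exports.

Local Open Scope classical_set_scope.
Local Open Scope ring_scope.

Section metrizability.
Context {R : realType} {T : Type}.
Implicit Types d : T -> T -> R.

Definition is_metric d :=
  [/\ forall x, d x x = 0,
      forall x y, d x y = 0 -> x = y,
      forall x y, d x y = d y x &
      forall y x z, d x z <= d x y + d y z].

Definition cauchy_seq d (u : nat -> T) :=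
  forall e : R, 0 < e ->
    exists N : nat, forall m n : nat, (N <= m)%N -> (N <= n)%N ->
      d (u m) (u n) < e.

End metrizability.

Definition induces_topology (R : realType) (T : topologicalType)
    (d : T -> T -> R) :=
  forall (x : T) (A : set T),
    nbhs x A <-> exists2 e : R, 0 < e & [set y | d x y < e] `<=` A.

Definition metrizable (R : realType) (T : topologicalType) :=
  exists d : T -> T -> R, is_metric d /\ induces_topology d.

Definition completely_metrizable (R : realType) (T : topologicalType) :=
  exists d : T -> T -> R,
    [/\ is_metric d, induces_topology d &
        forall u : nat -> T, cauchy_seq d u ->
          exists l : T, u n @[n --> \oo] --> l].

Definition separable (T : topologicalType) :=
  exists2 D : set T, countable D & dense D.

Definition baire_space (T : topologicalType) :=
  forall U : nat -> set T, (forall n, open (U n) /\ dense (U n)) ->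
    dense (\bigcap_n U n).

Definition hereditarily_baire (T : topologicalType) :=
  forall F : set T, closed F -> baire_space (set_type F).

Definition functionally_closed (R : realType) (T : topologicalType)
    (A : set T) :=
  exists2 f : T -> R, continuous f & A = [set x | f x = 0].

Definition functionally_Fsigma (R : realType) (T : topologicalType)
    (A : set T) :=
  exists2 F : nat -> set T, (forall n, functionally_closed R (F n)) &
    A = \bigcup_n F n.

Definition K1 (R : realType) (T Y : topologicalType) : set (T -> Y) :=
  [set f | forall V : set Y, open V -> functionally_Fsigma R (f @^-1` V)].

Definition K1_extension_property (R : realType) (X : topologicalType)
    (E : set X) (Y : topologicalType) :=
  forall f : set_type E -> Y, K1 R f ->
    exists2 g : X -> Y, K1 R g & forall x : set_type E, g (set_val x) = f x.

(* Closedness and monotonicity are standing conventions on such coverings; they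
   do not follow from the last condition. *)
Definition super_sequentially_absorbing (Y : topologicalType)
    (Y_ : nat -> set Y) :=
  [/\ \bigcup_n Y_ n = [set: Y],
      forall n, closed (Y_ n),
      forall n, Y_ n `<=` Y_ n.+1 &
      forall y : nat -> Y, (forall n, ~ Y_ n (y n)) -> closed (range y)].

(* Main.v *)
(* Proof idea.  A Baire category argument on closed subsets F of E shows that f
   maps some nonempty relatively open piece of F into a single Y_n, and that it
   maps some such piece, up to points outside of the preimage of Y_n, onto a set
   of small diameter for a complete metric of Y_n; for the former, the values
   of f on a countable dense subset of F escaping all the Y_n would form a closed
   discrete set.  Exhausting E by traces of cozero sets of X gives partitions of
   the whole of X into countably many functionally F_sigma pieces, on the trace of
   which f has these properties.  Refining the partitions successively, and
   choosing on every piece that meets E a value of f there, gives maps on X which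
   are countably valued with F_sigma fibres and which are uniformly Cauchy on each
   piece of the first partition; their limit extends f. *)
Require Import Defs.
From HB Require Import structures.
From mathcomp Require Import all_boot all_order all_algebra.
From mathcomp Require Import all_classical all_reals.
From mathcomp Require Import topology normedtype.
From mathcomp Require Import lra.

Set Implicit Arguments.
Unset Strict Implicit.
Unset Printing Implicit Defensive.

Import Order.TTheory GRing.Theory Num.Theory.
Import numFieldNormedType.Exports.

Local Open Scope classical_set_scope.
Local Open Scope ring_scope.

Lemma inv_nat_small (R : realType) (e : R) :
  0 < e -> exists N : nat, forall n, (N <= n)%N -> n.+1%:R^-1 < e.
Proof.
move=> e0; exists (Num.trunc e^-1) => n Nn.
have en : e^-1 < n.+1%:R.
  by apply: lt_le_trans (truncnS_gt e^-1) _; rewrite ler_nat ltnS.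
by rewrite -[ltRHS]invrK ltf_pV2 // posrE ?invr_gt0 // ltr0Sn.
Qed.

(** * Zero sets and functionally F_sigma sets *)

Section functionally_closed_theory.
Context {R : realType} {T : topologicalType}.
Implicit Types A B : set T.

Lemma functionally_closed_closed A : functionally_closed R A -> closed A.
Proof.
move=> [f cf ->]; rewrite (_ : [set _ | _] = f @^-1` [set 0])//.
by apply: closed_comp => [x _|]; [exact: cf|exact: closed_eq].
Qed.

Lemma functionally_closed0 : functionally_closed R (@set0 T).
Proof.
exists (fun=> 1); first by move=> x; exact: cvg_cst.
by apply/seteqP; split=> x //= /eqP; rewrite oner_eq0.
Qed.

Lemma functionally_closedT : functionally_closed R [set: T].
Proof.
by exists (fun=> 0) => [x|]; [exact: cvg_cst|apply/seteqP; split].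
Qed.

(* The witness is [sup_n (min |f_n| 1/(n+1))]; truncating makes all but finitely
   many terms uniformly small, whence continuity. *)
Lemma functionally_closed_bigcap (A : nat -> set T) :
  (forall n, functionally_closed R (A n)) ->
  functionally_closed R (\bigcap_n A n).
Proof.
move=> /(_ _)/cid2-/all_sig2[f cf Af].
pose t n x := Num.min `|f n x| n.+1%:R^-1 : R.
have t0 n x : 0 <= t n x by rewrite le_min normr_ge0 invr_ge0 ler0n.
have tn n x : t n x <= n.+1%:R^-1 by rewrite ge_min lexx orbT.
pose h x := sup (range (t ^~ x)).
have hs x : has_sup (range (t ^~ x)).
  split; first by exists (t 0%N x), 0%N.
  exists 1 => _ [n _ <-]; apply: le_trans (tn n x) _.
  by rewrite invf_le1 ?ltr0Sn// ler1n.
have ht n x : t n x <= h x by apply: ub_le_sup; [case: (hs x)|exists n].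
have hle x c : (forall n, t n x <= c) -> h x <= c.
  by move=> tc; apply: ge_sup; [case: (hs x)|move=> _ [n _ <-]].
exists h.
  move=> x; apply/cvgrPdist_le => e e0.
  have [N Ne] := inv_nat_small e0.
  have : \forall y \near x, forall n, (n < N)%N -> `|t n x - t n y| <= e.
    elim: N {Ne} => [|N IH]; first by near=> y.
    have ct : continuous (t N).
      move=> y; apply: (@continuous_min _ _ (fun x => `|f N x|) (fun=> N.+1%:R^-1)).
        by apply: continuous_comp; [exact: cf|exact: norm_continuous].
      exact: cvg_cst.
    have /cvgrPdist_le/(_ _ e0) := ct x.
    apply: filterS2 IH => y IH yN n; rewrite ltnS leq_eqVlt => /predU1P[->//|].
    exact: IH.
  apply: filterS => y ty.
  have {}ty n : `|t n x - t n y| <= e.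
    have [/ty//|/Ne ne] := ltnP n N.
    have := t0 n x; have := t0 n y; have := tn n x; have := tn n y.
    by move: ne; rewrite ler_norml; set c := _^-1; lra.
  rewrite ler_norml; apply/andP; split.
    rewrite lerBrDr addrC lerBlDr; apply: hle => n; have := ty n; have := ht n x.
    by rewrite ler_norml; lra.
  rewrite lerBlDr; apply: hle => n; have := ty n; have := ht n y.
  by rewrite ler_norml; lra.
apply/seteqP; split => [x Ax|x /= hx n _].
  apply/eqP; rewrite eq_le; apply/andP; split; last exact: le_trans (t0 0%N x) _.
  apply: hle => n; have := Ax n I; rewrite Af /t /= => ->.
  by rewrite normr0 ge_min lexx.
rewrite Af /=; apply/eqP; rewrite -normr_le0.
by have := ht n x; rewrite hx ge_min invr_le0 lern0 orbF.
Unshelve. all: by end_near. Qed.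

Lemma functionally_closedI A B : functionally_closed R A ->
  functionally_closed R B -> functionally_closed R (A `&` B).
Proof.
move=> fA fB; rewrite -bigcap2E; apply: functionally_closed_bigcap.
by move=> [|[|n]] //=; exact: functionally_closedT.
Qed.

Lemma functionally_Fsigma_closed A :
  functionally_closed R A -> functionally_Fsigma R A.
Proof. by move=> fA; exists (fun=> A) => //; rewrite bigcup_const. Qed.

(** The set where [f] does not vanish is the union of the sets [|f| >= 1/(n+1)], which are the zero
    sets of [min (|f| - 1/(n+1)) 0]. *)
Lemma functionally_FsigmaC A :
  functionally_closed R A -> functionally_Fsigma R (~` A).
Proof.
move=> [f cf ->].
exists (fun n => [set x | Num.min (`|f x| - n.+1%:R^-1) 0 = 0]).
  move=> n; exists (fun x => Num.min (`|f x| - n.+1%:R^-1) 0) => // x.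
  apply: (@continuous_min _ _ (fun x => `|f x| - n.+1%:R^-1) (fun=> 0)).
    apply: continuousB; last exact: cvg_cst.
    by apply: continuous_comp; [exact: cf|exact: norm_continuous].
  exact: cvg_cst.
apply/seteqP; split => [x /eqP|x [n _] /=].
  rewrite -normr_gt0 => /inv_nat_small[N /(_ _ (leqnn N)) fN]; exists N => //=.
  by apply/min_idPr; rewrite subr_ge0 ltW.
move=> /min_idPr; rewrite subr_ge0 => + /eqP; rewrite -normr_le0 => nf f0.
by have := le_trans nf f0; rewrite invr_le0 lern0.
Qed.

Lemma functionally_Fsigma_bigcup {I : countType} (D : set I) (A : I -> set T) :
  (forall i, D i -> functionally_Fsigma R (A i)) ->
  functionally_Fsigma R (\bigcup_(i in D) A i).
Proof.
move=> FA.
have /choice[F FP] : forall i, exists F : nat -> set T,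
    (forall n, functionally_closed R (F n)) /\
    \bigcup_n F n = if `[< D i >] then A i else set0.
  move=> i; case: asboolP => [/FA[F cF ->]|_]; first by exists F.
  exists (fun=> set0); split; last by rewrite bigcup0.
  by move=> _; exact: functionally_closed0.
exists (fun k => if unpickle k is Some (i, n) then F i n else set0).
  move=> k; case: unpickle => [[i n]|]; last exact: functionally_closed0.
  by have [] := FP i.
apply/seteqP; split => [x [i Di Aix]|x [k _]].
  have [_] := FP i; rewrite asboolT// => E.
  have [n _ Fx] : (\bigcup_n F i n) x by rewrite E.
  by exists (pickle (i, n)) => //=; rewrite pickleK.
case: unpickle => [[i n]|]// Fx.
have [_ E] := FP i; have : (\bigcup_n F i n) x by exists n.
by rewrite E; case: asboolP => // Di Ax; exists i.
Qed.

Lemma functionally_FsigmaI A B : functionally_Fsigma R A ->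
  functionally_Fsigma R B -> functionally_Fsigma R (A `&` B).
Proof.
move=> [F cF ->] [G cG ->].
rewrite setI_bigcupl; apply: functionally_Fsigma_bigcup => i _.
rewrite setI_bigcupr; apply: functionally_Fsigma_bigcup => j _.
by apply: functionally_Fsigma_closed; exact: functionally_closedI.
Qed.

End functionally_closed_theory.

(** * Countable bases and traces of cozero sets *)

Lemma induces_topology_ball_open (R : realType) (T : topologicalType)
    (d : T -> T -> R) x e : is_metric d -> induces_topology d ->
  open [set y | d x y < e].
Proof.
move=> [_ _ _ tri] dT; rewrite openE => y /= xy; apply/dT.
exists (e - d x y) => [|z /= yz]; first by rewrite subr_gt0.
by apply: le_lt_trans (tri y _ _) _; rewrite -ltrBrDl.
Qed.

Lemma separable_metrizable_base (R : realType) (T : topologicalType) :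
  metrizable R T -> separable T -> exists U : nat -> set T,
    (forall k, open (U k)) /\
    forall x O, open O -> O x -> exists2 k, U k x & U k `<=` O.
Proof.
move=> [d [md dT]] [D /countable_injP[g gD] dD]; have [d0 _ ds tri] := md.
(* As [g] is injective on [D], this union has at most one term: the ball of radius [1/(n+1)] about
   the point numbered [i]. *)
exists (fun k => if unpickle k is Some (i, n) then
  \bigcup_(p in [set p | D p /\ g p = i]) [set y | d p y < n.+1%:R^-1]
  else set0).
split=> [k|x O oO Ox].
  case: unpickle => [[i n]|]; last exact: open0.
  by apply: bigcup_open => p _; exact: induces_topology_ball_open.
have /dT[e e0 eO] : nbhs x O by exact: open_nbhs_nbhs.
have e20 : 0 < e / 2 by rewrite divr_gt0.
have [N /(_ _ (leqnn N)) Ne] := inv_nat_small e20.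
have [|p [/= xp Dp]] := dD [set y | d x y < N.+1%:R^-1] _
  (induces_topology_ball_open _ _ md dT).
  by exists x; rewrite /= d0 invr_gt0 ltr0Sn.
exists (pickle (g p, N)); rewrite pickleK.
  by exists p => //=; rewrite ds.
move=> y [q [/= Dq gqp]] qy; apply: eO; move: qy => /=.
have -> : q = p by apply: gD; rewrite ?inE.
move=> py; have := tri p x y; move: xp Ne py => /=; set c := _^-1; lra.
Qed.

Section subspace.
Context {R : realType} {X : topologicalType} {E : set X}.

(* Each pair of base sets [U_i], [U_j] contributes one cozero set whose trace
   lies between them, if there is any. *)
Lemma cozero_trace_base : completely_regular_space X ->
  metrizable R (set_type E) -> separable (set_type E) ->
  exists V : nat -> set X,
    (forall k, functionally_closed R (~` V k)) /\
    forall (x : set_type E) O, open O -> O x ->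
      exists2 k, V k (val x) & set_val @^-1` V k `<=` O.
Proof.
move=> crX mE sE; have [U [oU Ubase]] := separable_metrizable_base mE sE.
pose good i j (V : set X) := functionally_closed R (~` V) /\
  (U i `<=` set_val @^-1` V /\ set_val @^-1` V `<=` U j).
have /choice[V VP] : forall k, exists V : set X, functionally_closed R (~` V) /\
    forall i j W, unpickle k = Some (i, j) -> good i j W -> good i j V.
  move=> k; case: (unpickle k) => [[i j]|]; last first.
    by exists setT; split=> //; rewrite setCT; exact: functionally_closed0.
  have [[V gV]|nV] := pselect (exists V, good i j V).
    by exists V; split=> [|? ? ? [<- <-]//]; case: gV.
  exists setT; split; first by rewrite setCT; exact: functionally_closed0.
  by move=> ? ? W [<- <-] gW; case: nV; exists W.
exists V; split=> [k|x O oO Ox]; first by case: (VP k).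
have [j Ujx UjO] := Ubase _ _ oO Ox.
(* Complete regularity separates [x] from the complement of an open [B] with trace [U j]; this gives
   a cozero set [W] around [x] with trace inside [U j]. *)
have [B oB UB] := oU j.
have Bx : (set_val @^-1` B : set (set_type E)) x by rewrite UB.
have nBx : ~ (~` B) (val x) by move=> /(_ Bx).
have /(uniform_separatorP (R := R))[h [ch h01 h0 h1]] :=
  crX _ _ (open_closedC oB) nBx.
pose W := [set y | h y != 1].
have fW : functionally_closed R (~` W).
  exists (fun y => h y - 1).
    by move=> y; apply: continuousB; [exact: ch|exact: cvg_cst].
  apply/seteqP; split=> y /=.
    by have [->|//] := eqVneq (h y) 1; rewrite subrr.
  by move=> /eqP; rewrite subr_eq0 => hy; apply/negP; rewrite negbK.
have Wx : W (val x).
  have hx : h (val x) = 0 by apply: h0; exists (val x).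
  by rewrite /W /= hx eq_sym oner_neq0.
have oW : open (set_val @^-1` W : set (set_type E)).
  exists W => //; rewrite -(setCK W); apply: closed_openC.
  exact: functionally_closed_closed fW.
(* Now [W] shows that the pair [(i, j)] admits a good set, so the set chosen for its code is
   good. *)
have [i Uix UiW] := Ubase _ _ oW Wx.
have gW : good i j W.
  split=> //; split=> // y /= Wy; rewrite -UB; apply: contrapT => nBy.
  by move: Wy; rewrite /W /= (_ : h _ = 1) ?eqxx//; apply: h1; exists (set_val y).
have [_ /(_ i j W)] := VP (pickle (i, j)).
rewrite pickleK => /(_ erefl gW)[_ [UiV VUj]].
by exists (pickle (i, j)); [exact: UiV|exact: subset_trans UjO].
Qed.

End subspace.

(** * Baire category on closed subsets *)

(** Otherwise the complements of the [C i] are dense and open in the Baire space [F], and a point of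
    their intersection is not covered. *)
Lemma hereditarily_baire_cover (T : topologicalType) (J : countType)
    (F : set T) (C : J -> set T) :
  hereditarily_baire T -> closed F -> F !=set0 -> (forall i, closed (C i)) ->
  F `<=` \bigcup_i C i ->
  exists i U, [/\ open U, U `&` F !=set0 & U `&` F `<=` C i].
Proof.
move=> bT cF [a Fa] cC FC; apply: contrapT => nC.
pose W k : set (set_type F) :=
  if unpickle k is Some i then ~` (set_val @^-1` C i) else setT.
have [k|x [_ Wx]] := bT F cF W _ setT (ex_intro _ (SigSub (mem_set Fa)) I) openT.
  rewrite /W; case: unpickle => [i|]; last first.
    by split; [exact: openT|move=> O [x Ox] _; exists x].
  split.
    by exists (~` C i) => //; exact: closed_openC.
  move=> O [x Ox] [U oU UO].
  apply: contrapT => nO; apply: nC; exists i, U; split=> //.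
    by exists (val x); split; [move: Ox; rewrite -UO|exact: set_valP].
  move=> y [Uy Fy]; apply: contrapT => nCy; apply: nO.
  by exists (SigSub (mem_set Fy)); split=> //; rewrite -UO.
have [i _ Cx] := FC _ (set_valP x).
by have := Wx (pickle i) I; rewrite /W pickleK; apply.
Qed.

(** The sets [O i] and the complement of [G] (index [None]) cover [Y], and their preimages are
    countable unions of closed sets, so one preimage contains a piece of [F]. The last hypothesis
    excludes [None]. *)
Lemma K1_baire_cover (R : realType) (T Y : topologicalType) (I : countType)
    (f : T -> Y) (F : set T) (G : set Y) (O : I -> set Y) :
  hereditarily_baire T -> K1 R f -> closed F -> F !=set0 -> closed G ->
  (forall i, open (O i)) -> G `<=` \bigcup_i O i ->
  (forall U, open U -> U `&` F !=set0 -> U `&` F `&` f @^-1` G !=set0) ->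
  exists i U, [/\ open U, U `&` F !=set0 &
    U `&` F `&` f @^-1` G `<=` f @^-1` O i].
Proof.
move=> bT Kf cF F0 cG oO GO dG.
pose W o := if o is Some i then O i else ~` G.
have oW o : open (W o) by case: o => [i|] //=; exact: closed_openC.
have /(_ _)/cid2-/all_sig2[K cK WK] o := Kf _ (oW o).
have [||[o n] [U [oU UF UK]]] := @hereditarily_baire_cover _ _ F
  (fun p : option I * nat => K p.1 p.2) bT cF F0.
- by case=> o n; apply: functionally_closed_closed (cK o n).
- move=> x Fx; have [Gfx|nGfx] := pselect (G (f x)).
    have [i _ Ofx] := GO _ Gfx.
    have : (f @^-1` W (Some i)) x by [].
    by rewrite WK => -[n _ Kx]; exists (Some i, n).
  have : (f @^-1` W None) x by [].
  by rewrite WK => -[n _ Kx]; exists (None, n).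
have UW : U `&` F `<=` f @^-1` W o by move=> x /UK Kx; rewrite WK; exists n.
case: o {UK} UW => [i|] UW; last by have [x [/UW]] := dG _ oU UF.
by exists i, U; split=> // x [/UW].
Qed.

(** * Complete metrics on subspaces *)

(* [D] is a pseudometric on the whole of [Y], and on [A] it is a complete metric
   inducing the subspace topology. *)
Record complete_metric_on (R : realType) (Y : topologicalType) (A : set Y)
    (D : Y -> Y -> R) : Prop := CompleteMetricOn {
  cmo_refl : forall y, D y y = 0;
  cmo_sym : forall y z, D y z = D z y;
  cmo_triangle : forall y x z, D x z <= D x y + D y z;
  cmo_eq : forall y z, A y -> A z -> D y z = 0 -> y = z;
  cmo_nbhs : forall (V : set Y) y, open V -> V y -> A y ->
    exists2 e, 0 < e & forall z, A z -> D y z < e -> V z;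
  cmo_ball : forall y e, exists2 O : set Y, open O &
    forall z, A z -> O z <-> D y z < e;
  cmo_complete : forall u : nat -> Y, (forall n, A (u n)) -> cauchy_seq D u ->
    exists2 l, A l & forall e, 0 < e ->
      exists N, forall n, (N <= n)%N -> D (u n) l < e }.

Lemma completely_metrizable_on (R : realType) (Y : topologicalType)
    (A : set Y) : completely_metrizable R (set_type A) ->
  exists D : Y -> Y -> R, complete_metric_on A D.
Proof.
have [->|/set0P[a Aa]] := eqVneq A set0.
  move=> _; exists (fun _ _ => 0); split=> //; first by move=> *; rewrite addr0.
  - by move=> y e; exists set0 => //; exact: open0.
  - by move=> u /(_ 0%N).
move=> [d [md dT dC]]; have [d0 deq ds tri] := md.
(* [p] is the identity on [A] and sends all other points to [a]; [d] is pulled back along it. *)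
pose p : Y -> set_type A := insubd (SigSub (mem_set Aa)).
have pK y : A y -> set_val (p y) = y.
  by move=> Ay; apply: insubdK; exact: mem_set.
have pV (y : set_type A) : p (set_val y) = y by exact: valKd.
exists (fun y z => d (p y) (p z)); split=> //.
- by move=> y z Ay Az /deq /(congr1 set_val); rewrite !pK.
- move=> V y oV Vy Ay.
  have : nbhs (p y) (set_val @^-1` V).
    apply: open_nbhs_nbhs; split; first by exists V.
    by rewrite /= pK.
  move=> /dT[e e0 eV]; exists e => // z Az yz.
  by have /= := eV _ yz; rewrite pK.
- move=> y e; have [O oO BO] := induces_topology_ball_open
    (p y) e md dT.
  exists O => // z Az; rewrite -[D in D <-> _]/(O z) -{1}(pK _ Az).
  by rewrite -[O _]/((set_val @^-1` O) (p z)) BO.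
- move=> u Au /dC[l ul]; exists (set_val l); first exact: set_valP.
  move=> e e0; rewrite pV.
  have : nbhs l [set y | d l y < e] by apply/dT; exists e.
  move=> /ul[N _ Nu]; exists N => n /Nu /=; by rewrite ds.
Qed.

(** * Pieces on which [f] is absorbed or oscillates little *)

Section pieces.
Context {R : realType} {T Y : topologicalType}.
Variables (f : T -> Y) (U : nat -> set T).
Hypotheses (bT : hereditarily_baire T) (Kf : K1 R f).
Hypotheses (oU : forall k, open (U k))
  (U_base : forall x O, open O -> O x -> exists2 k, U k x & U k `<=` O).

Let base_meets (F O : set T) : open O -> O `&` F !=set0 ->
  exists2 k, U k `&` F !=set0 & U k `<=` O.
Proof.
move=> oO [x [Ox Fx]]; have [k Ux UO] := U_base oO Ox.
by exists k => //; exists x.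
Qed.

(** Otherwise each base set meeting [F] contains two points of [F] with values in [A] at distance at
    least [e]. Countably many balls of radius [e / 2] about these values cover their closure, so on
    some piece the chosen values all lie in one ball; a pair chosen inside that piece is then too
    close. *)
Lemma small_oscillation_piece (A : set Y) (D : Y -> Y -> R) (F : set T) e :
  complete_metric_on A D -> closed A -> 0 < e -> closed F -> F !=set0 ->
  exists O, [/\ open O, O `&` F !=set0 & forall x z, (O `&` F) x ->
    (O `&` F) z -> A (f x) -> A (f z) -> D (f x) (f z) < e].
Proof.
move=> mD cA e0 cF F0; have [a Fa] := F0; apply: contrapT => nO.
have /choice[x xP] : forall k, exists x : bool -> T, U k `&` F !=set0 ->
    (forall b, (U k `&` F) (x b) /\ A (f (x b))) /\
    e <= D (f (x true)) (f (x false)).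
  move=> k; apply: contrapT => nx; apply: nO; exists (U k).
  have UF : U k `&` F !=set0.
    by apply: contrapT => nUF; apply: nx; exists (fun=> a).
  split=> // y z UFy UFz Ay Az; rewrite ltNge; apply/negP => De; apply: nx.
  by exists (fun b => if b then y else z) => _; split=> // -[].
pose S := [set y | exists k b, U k `&` F !=set0 /\ y = f (x k b)].
have SA : closure S `<=` A.
  rewrite [X in _ `<=` X](_ : A = closure A); last exact/closure_id.
  by apply: closure_subset => _ [k [b [/xP[/(_ b)[_ Ax] _] ->]]].
have /choice[O OP] : forall kb : nat * bool, exists O : set Y, open O /\
    forall z, A z -> O z <-> D (f (x kb.1 kb.2)) z < e / 2.
  by move=> kb; have [O ? ?] := cmo_ball mD (f (x kb.1 kb.2)) (e / 2); exists O.
have := @K1_baire_cover _ _ _ _ f F (closure S) O bT Kf cF F0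
  (@closed_closure _ S).
case.
- by move=> i; case: (OP i).
- move=> z Sz; have Az := SA _ Sz.
  have [B oB BP] := cmo_ball mD z (e / 2).
  have Bz : B z by apply/BP => //; rewrite (cmo_refl mD) divr_gt0.
  have [_ [[k [b [UF ->]]] Bx]] := Sz _ (open_nbhs_nbhs (conj oB Bz)).
  exists (k, b) => //; have [_ /(_ _ Az) ->] := OP (k, b).
  rewrite (cmo_sym mD); apply/BP => //.
  by have [/(_ b)[]] := xP _ UF.
- move=> V oV /(base_meets oV)[k UF UV].
  have [/(_ true)[[Ux Fx] _] _] := xP _ UF.
  exists (x k true); split; first by split; [exact: UV|].
  by apply: subset_closure; exists k, true.
- move=> i [V [oV /(base_meets oV)[k UF UV] VO]].
  have [xUF] := xP _ UF; apply/negP; rewrite -ltNge.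
  have close b : D (f (x i.1 i.2)) (f (x k b)) < e / 2.
    have [[Ux Fx] Ax] := xUF b; have [_ <-//] := OP i.
    apply: VO; split; first by split; [exact: UV|].
    by apply: subset_closure; exists k, b.
  have := cmo_triangle mD (f (x i.1 i.2)) (f (x k true)) (f (x k false)).
  have := close true; have := close false.
  by rewrite [D (f (x k true)) (f (x i.1 i.2))](cmo_sym mD); lra.
Qed.

Lemma absorbing_le (Y_ : nat -> set Y) m n :
  super_sequentially_absorbing Y_ -> (m <= n)%N -> Y_ m `<=` Y_ n.
Proof.
move=> [_ _ YS _] /subnK <-; elim: (n - m)%N => // k IH.
by apply: subset_trans (IH) _; exact: YS.
Qed.

(** Once [Y_ j] contains [d], the sequence avoids [d] from index [j] on. Replacing each term equal
    to [d] by the one [j] places later removes [d] from the range and keeps the sequence escaping,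
    because the covering increases. *)
Lemma absorbing_rangeD1 (Y_ : nat -> set Y) (y : nat -> Y) d :
  super_sequentially_absorbing Y_ -> (forall n, ~ Y_ n (y n)) ->
  closed (range y `\ d).
Proof.
move=> aY ny; have [YT _ _ cY] := aY.
have [j _ Yjd] : (\bigcup_n Y_ n) d by rewrite YT.
have yd n : (j <= n)%N -> y n <> d.
  by move=> jn yd; apply: (ny n); rewrite yd; exact: absorbing_le Yjd.
pose y' n := if y n == d then y (n + j)%N else y n.
rewrite (_ : _ `\ d = range y').
  apply: cY => n; rewrite /y'; case: eqP => _ //.
  by move=> /(absorbing_le aY (leq_addr j n)); exact: ny.
apply/seteqP; split=> [_ [[n _ <-] /eqP nd]|_ [n _ <-]].
  by exists n => //; rewrite /y' (negbTE nd).
rewrite /y'; case: eqP => [_|nd]; split=> //=; first by exists (n + j)%N.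
  exact: yd (leq_addl n j).
by exists n.
Qed.

(** Otherwise points dense in [F] have values forming an escaping sequence, whose range is closed
    and discrete. By category, on some piece every value in the range is a single [y m]; yet each
    base set meeting [F] contains chosen points with values outside any given member of the
    covering. *)
Lemma absorbed_piece (Y_ : nat -> set Y) (F : set T) :
  super_sequentially_absorbing Y_ -> closed F -> F !=set0 ->
  exists O, [/\ open O, O `&` F !=set0 &
    exists n, O `&` F `<=` f @^-1` Y_ n].
Proof.
move=> aY cF F0; have [YT _ _ cY] := aY; apply: contrapT => nO.
have esc O n : open O -> O `&` F !=set0 -> exists2 x, (O `&` F) x & ~ Y_ n (f x).
  move=> oO OF; apply: contrapT => nx; apply: nO; exists O; split=> //; exists n.
  by move=> x OFx; apply: contrapT => nY; apply: nx; exists x.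
have /choice[x xP] : forall m, exists x, [/\ F x, ~ Y_ m (f x) &
    forall k i, unpickle m = Some (k, i) -> U k `&` F !=set0 ->
      U k x /\ ~ Y_ i (f x)].
  move=> m.
  have [[k [i [Em UF]]]|nm] := pselect (exists k i : nat,
      unpickle m = Some (k, i) /\ U k `&` F !=set0).
    (* The index [m + i] keeps the value out of both [Y_ m] and [Y_ i]. *)
    have [x [Ux Fx] nY] := esc _ (m + i)%N (oU k) UF.
    exists x; split=> //.
      by move=> /(absorbing_le aY (leq_addr i m)); exact: nY.
    move=> k' i'; rewrite Em => -[<- <-] _; split=> //.
    by move=> /(absorbing_le aY (leq_addl m i)); exact: nY.
  have [|x [_ Fx] nY] := esc setT m openT; first by rewrite setTI.
  by exists x; split=> // k i Em UF; case: nm; exists k, i.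
pose y n := f (x n).
have ny n : ~ Y_ n (y n) by have [_ + _] := xP n.
have := @K1_baire_cover _ _ _ _ f F (range y) (fun m => ~` (range y `\ y m)) bT Kf
  cF F0 (cY _ ny).
case.
- by move=> m; apply: closed_openC; exact: absorbing_rangeD1 aY ny.
- by move=> _ [m _ <-]; exists m => // -[_]; apply.
- move=> V oV /(base_meets oV)[k UF UV].
  have [Fx _ /(_ k 0%N (pickleK _) UF)[Ux _]] := xP (pickle (k, 0%N)).
  exists (x (pickle (k, 0%N))); split; first by split; [exact: UV|].
  by exists (pickle (k, 0%N)).
- move=> m [V [oV /(base_meets oV)[k UF UV] Vy]].
  have [j _ Yj] : (\bigcup_n Y_ n) (y m) by rewrite YT.
  (* As [y m] lies in [Y_ j], the point with code [(k, j)] has a value other than [y m]. *)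
  have [Fx _ /(_ k j (pickleK _) UF)[Ux nY]] := xP (pickle (k, j)).
  apply: (Vy (x (pickle (k, j)))); split.
  + by split; [exact: UV|].
  + by exists (pickle (k, j)).
  + by exists (pickle (k, j)).
  + by move=> /= E; apply: nY; rewrite E.
Qed.

End pieces.

(** * Partitions of [X] into functionally F_sigma pieces *)

Section partition.
Context {R : realType} {X : topologicalType} {E : set X}.

Lemma functionally_Fsigma_ord_bigcap (A : nat -> set X) n :
  (forall i, functionally_Fsigma R (A i)) ->
  functionally_Fsigma R (\bigcap_(i in `I_n) A i).
Proof.
move=> FA; elim: n => [|n IH].
  rewrite II0 bigcap_set0; apply: functionally_Fsigma_closed.
  exact: functionally_closedT.
by rewrite IIS bigcap_setU bigcap_set1; exact: functionally_FsigmaI.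
Qed.

(** Left abstract because it serves twice: for absorption by one [Y_ n] and for small
    oscillation. *)
Variable good : set (set_type E) -> Prop.
Hypotheses (good0 : good set0)
  (goodW : forall A B, A `<=` B -> good B -> good A).

Let covered (V : set X) := exists Z : nat -> set X,
  [/\ forall n, functionally_closed R (Z n),
      forall n, good (set_val @^-1` Z n) & V `<=` \bigcup_n Z n].

Let covered_Fsigma (V : set X) :
  functionally_Fsigma R V -> good (set_val @^-1` V) -> covered V.
Proof.
move=> [Z cZ ->] gV; exists Z; split=> // n; apply: goodW gV => x Zx.
by exists n.
Qed.

Let covered_bigcup (V : nat -> set X) :
  (forall k, covered (V k)) -> covered (\bigcup_k V k).
Proof.
move=> /choice[Z ZP].
exists (fun m => if unpickle m is Some (k, n) then Z k n else set0); split.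
- move=> m; case: unpickle => [[k n]|]; last exact: functionally_closed0.
  by have [] := ZP k.
- move=> m; case: unpickle => [[k n]|]; last by rewrite preimage_set0.
  by have [] := ZP k.
- move=> x [k _ Vx]; have [_ _ /(_ _ Vx)[n _ Zx]] := ZP k.
  by exists (pickle (k, n)) => //=; rewrite pickleK.
Qed.

Let covered0 : covered set0.
Proof.
apply: covered_Fsigma; last by rewrite preimage_set0.
apply: functionally_Fsigma_closed; exact: functionally_closed0.
Qed.

Let coveredU V W : covered V -> covered W -> covered (V `|` W).
Proof.
move=> cV cW; rewrite -bigcup2E; apply: covered_bigcup.
by move=> [|[|k]].
Qed.

(* The largest open set [W] covered by countably many good zero sets contains
   [E]: otherwise the hypothesis provides a good piece of [E \ W]. *)
Lemma good_partition (V : nat -> set X) :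
  (forall k, functionally_closed R (~` V k)) ->
  (forall (x : set_type E) O, open O -> O x ->
    exists2 k, V k (val x) & set_val @^-1` V k `<=` O) ->
  (forall F : set (set_type E), closed F -> F !=set0 ->
    exists O, [/\ open O, O `&` F !=set0 & good (O `&` F)]) ->
  exists P : X -> nat, forall i,
    functionally_Fsigma R (P @^-1` [set i]) /\
    good (set_val @^-1` (P @^-1` [set i])).
Proof.
move=> cV V_base goodP.
pose W := \bigcup_k (if `[< covered (V k) >] then V k else set0).
have cW : covered W by apply: covered_bigcup => k; case: asboolP.
have fW : functionally_closed R (~` W).
  rewrite setC_bigcup; apply: functionally_closed_bigcap => k.
  case: ifP => _; first exact: cV.
  by rewrite setC0; exact: functionally_closedT.
have EW (x : set_type E) : W (val x).
  apply: contrapT => nWx.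
  have [||O [oO [y [Oy nWy]] gO]] := goodP (set_val @^-1` (~` W)).
  - apply: closed_comp; last exact: functionally_closed_closed fW.
    by move=> y _; exact: initial_continuous.
  - by exists x.
  have [k Vy VO] := V_base _ _ oO Oy.
  suff cVk : covered (V k) by apply: nWy; exists k => //; rewrite asboolT.
  (* Outside of [W], the trace of [V k] lies in the good piece. *)
  have [|Z [cZ gZ VZ]] := @coveredU W (V k `&` ~` W) cW.
    apply: covered_Fsigma.
      apply: functionally_FsigmaI; last exact: functionally_Fsigma_closed.
      by rewrite -(setCK (V k)); exact: functionally_FsigmaC.
    by apply: goodW gO => z [Vz nWz]; split=> //; exact: VO.
  exists Z; split=> // z Vz; apply: VZ.
  by have [Wz|nWz] := pselect (W z); [left|right].
(* The complement of [W] misses [E], so its trace is empty, hence good, and all of [X] is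
   covered. *)
have [|Z [cZ gZ TZ]] := @coveredU W (~` W) cW.
  apply: covered_Fsigma; first exact: functionally_Fsigma_closed.
  by rewrite (_ : _ @^-1` _ = set0)// -subset0 => x /(_ (EW x)).
rewrite setUv in TZ.
have ZP x : exists n, `[< Z n x >] by have [n _ Zx] := TZ x I; exists n; apply/asboolP.
(* Taking the least index makes the fibres [Z i] minus finitely many zero sets. *)
pose P x := ex_minn (ZP x).
exists P => i; split; last first.
  by apply: goodW (gZ i) => x /= <-; rewrite /P; case: ex_minnP => m /asboolP.
rewrite (_ : _ @^-1` _ = Z i `&` \bigcap_(j in `I_i) (~` Z j)).
  apply: functionally_FsigmaI; first exact: functionally_Fsigma_closed.
  by apply: functionally_Fsigma_ord_bigcap => j; exact: functionally_FsigmaC.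
apply/seteqP; split=> [x /= <-|x /= [Zx nZ]]; rewrite /P; case: ex_minnP.
  move=> m /asboolP Zx mZ; split=> // j /= jm Zjx.
  by have := mZ j; rewrite asboolT// leqNgt jm => /(_ isT).
move=> m /asboolP Zmx /(_ i); rewrite asboolT// => /(_ isT).
by rewrite leq_eqVlt => /predU1P[//|/nZ].
Qed.

End partition.

(** * The extension as a limit of countably valued maps *)

Section extension.
Context {R : realType} {X Y : topologicalType} {E : set X}.
Variables (f : set_type E -> Y) (Y_ : nat -> set Y) (D : nat -> Y -> Y -> R).
Variables (P0 : X -> nat) (N : nat -> nat) (P : nat -> nat -> X -> nat) (y0 : Y).
Hypotheses (mD : forall n, complete_metric_on (Y_ n) (D n))
  (FP0 : forall i, functionally_Fsigma R (P0 @^-1` [set i]))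
  (FP : forall n m i, functionally_Fsigma R (P n m @^-1` [set i]))
  (fP0 : forall x, Y_ (N (P0 (val x))) (f x))
  (fP : forall n m x z, P n m (val x) = P n m (val z) ->
    Y_ n (f x) -> Y_ n (f z) -> D n (f x) (f z) < m.+1%:R^-1)
  (y0N : forall i, Y_ (N i) y0).

(* The labels, latest first, of the pieces of the first partitions that contain
   [x]; the label given by [P0] fixes the metric used afterwards. *)
Fixpoint address (m : nat) (x : X) : seq nat :=
  if m is m'.+1 then P (N (P0 x)) m' x :: address m' x else [:: P0 x].

(* A value of [f] on the piece of [E] with address [w], or on the smallest piece
   above it that meets [E]. *)
Fixpoint address_value (w : seq nat) : Y :=
  if w is _ :: w' then
    if pselect (exists x : set_type E, address (size w') (val x) = w) is left h
    then f (projT1 (cid h)) else address_value w'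
  else y0.

Lemma size_address m x : size (address m x) = m.+1.
Proof. by elim: m => //= m ->. Qed.

Lemma last_address m x : last 0%N (address m x) = P0 x.
Proof.
by case: m => //= m; elim: m (P _ _ _) => //= m IH a; exact: IH.
Qed.

Lemma address_le m k x z : (m <= k)%N ->
  address k x = address k z -> address m x = address m z.
Proof.
move=> /subnK <-; elim: (k - m)%N => // j IH.
by rewrite addSn /= => -[_]; exact: IH.
Qed.

Lemma address_P0 m x z : address m x = address m z -> P0 x = P0 z.
Proof. by move=> /(address_le (leq0n m)) /= []. Qed.

Lemma address_Fsigma m w :
  functionally_Fsigma R (address m @^-1` [set w]).
Proof.
have F0 : functionally_Fsigma R (@set0 X).
  by apply: functionally_Fsigma_closed; exact: functionally_closed0.
elim: m w => [|m IH] [|a w].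
- by rewrite (_ : _ @^-1` _ = set0)// -subset0.
- case: w => [|b w]; last by rewrite (_ : _ @^-1` _ = set0)// -subset0.
  rewrite (_ : _ @^-1` _ = P0 @^-1` [set a])//.
  by apply/seteqP; split=> x /= => [[]|->].
- by rewrite (_ : _ @^-1` _ = set0)// -subset0.
(* The partition that gives the new label depends on [P0 x], hence the splitting over the values of
   [P0]. *)
rewrite (_ : _ @^-1` _ = \bigcup_n (P0 @^-1` [set n] `&`
    P (N n) m @^-1` [set a]) `&` address m @^-1` [set w]).
  apply: functionally_FsigmaI => //; apply: functionally_Fsigma_bigcup => n _.
  exact: functionally_FsigmaI.
apply/seteqP; split=> [x /= [Pa qw]|x /= [[n _ [/= <- <-]] <-]//].
by split=> //; exists (P0 x).
Qed.

Lemma address_value_trace m x (e : set_type E) :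
  address m (val e) = address m x ->
  exists2 z : set_type E, address m (val z) = address m x &
    address_value (address m x) = f z.
Proof.
move=> ex; have sx := size_address m x.
case: (address m x) ex sx => // a w ex [sw] /=; rewrite sw.
case: pselect => [h|[]]; last by exists e.
by exists (projT1 (cid h)) => //; case: (cid h).
Qed.

Lemma address_value_stable m x :
  ~ (exists e : set_type E, address m.+1 (val e) = address m.+1 x) ->
  address_value (address m.+1 x) = address_value (address m x).
Proof. by move=> ne /=; rewrite size_address; case: pselect. Qed.

(** Each further label either inherits the value or takes it at a point of [E] in the finer piece,
    thus also in the coarser one. *)
Lemma address_value_below m k x : (m <= k)%N ->
  address_value (address k x) = address_value (address m x) \/
  exists2 z : set_type E, address m (val z) = address m x &
    address_value (address k x) = f z.
Proof.
move=> /subnK <-; elim: (k - m)%N => [|j IH]; first by left.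
rewrite addSn.
have [[e ex]|/address_value_stable ->//] := pselect
  (exists e : set_type E, address (j + m).+1 (val e) = address (j + m).+1 x).
have [z zx ->] := address_value_trace ex; right; exists z => //.
by apply: address_le zx; rewrite -addSn leq_addl.
Qed.

Lemma address_value_in m x : Y_ (N (P0 x)) (address_value (address m x)).
Proof.
elim: m => [|m IH].
  have [[e ex]|ne] := pselect (exists e : set_type E,
      address 0 (val e) = address 0 x).
    have [z zx ->] := address_value_trace ex.
    by rewrite -(address_P0 zx).
  (* A piece missing [E] gets the default [y0], which lies in every [Y_ (N i)]. *)
  by move: ne => /=; case: pselect => //= _ _; exact: y0N.
have [[e ex]|/address_value_stable ->//] := pselect
  (exists e : set_type E, address m.+1 (val e) = address m.+1 x).
have [z zx ->] := address_value_trace ex.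
by rewrite -(address_P0 zx).
Qed.

(** Equal addresses share the [P0] label, hence the metric; the head of [address m.+1] comes from
    the partition of index [m], hence the bound. *)
Lemma address_trace_close m x (e z : set_type E) :
  address m.+1 (val e) = address m.+1 x ->
  address m.+1 (val z) = address m.+1 x ->
  D (N (P0 x)) (f e) (f z) < m.+1%:R^-1.
Proof.
move=> ex zx; have E0 := address_P0 ex; have Z0 := address_P0 zx.
apply: fP; last 2 first.
- by rewrite -E0.
- by rewrite -Z0.
by move: ex zx => /= [+ _] [+ _]; rewrite E0 Z0 => -> ->.
Qed.

(** If the value changes later, the piece of address [address m.+1 x] meets [E], so both values are
    values of [f] on it. *)
Lemma address_value_cauchy m k x : (m < k)%N ->
  D (N (P0 x)) (address_value (address m.+1 x)) (address_value (address k x)) <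
  m.+1%:R^-1.
Proof.
move=> /(address_value_below x)[->|[z zx ->]].
  by rewrite (cmo_refl (mD _)) invr_gt0 ltr0Sn.
by have [e ex ->] := address_value_trace zx; exact: address_trace_close.
Qed.

Lemma address_limit x : exists2 l, Y_ (N (P0 x)) l &
  forall m, D (N (P0 x)) (address_value (address m.+1 x)) l <= m.+1%:R^-1.
Proof.
set n := N (P0 x).
have [|e e0|l Yl ul] := cmo_complete (mD n) (u := fun m => address_value (address m x)).
- by move=> m; exact: address_value_in.
- have [M /(_ _ (leqnn M)) Me] := inv_nat_small (divr_gt0 e0 (ltr0Sn R 1)).
  exists M.+1 => i j Mi Mj.
  have := cmo_triangle (mD n) (address_value (address M.+1 x))
    (address_value (address i x)) (address_value (address j x)).
  have := address_value_cauchy x Mi; have := address_value_cauchy x Mj.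
  rewrite -/n (cmo_sym (mD n) (address_value (address i x))
    (address_value (address M.+1 x))).
  by move: Me; set c := _^-1; lra.
exists l => // m; apply/ler_addgt0Pr => e e0.
have [M MP] := ul e e0.
have := MP (maxn M m.+1) (leq_maxl _ _).
have := address_value_cauchy x (leq_maxr M m.+1); rewrite -/n.
have := cmo_triangle (mD n) (address_value (address (maxn M m.+1) x))
  (address_value (address m.+1 x)) l.
by set c := _^-1; lra.
Qed.

Lemma K1_extension_of_partitions :
  exists2 g : X -> Y, K1 R g & forall x : set_type E, g (set_val x) = f x.
Proof.
have /choice[g gP] : forall x, exists l, Y_ (N (P0 x)) l /\
    forall m, D (N (P0 x)) (address_value (address m.+1 x)) l <= m.+1%:R^-1.
  by move=> x; have [l ? ?] := address_limit x; exists l.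
exists g.
  move=> V oV.
  (* The addresses whose error bound alone forces the limit into [V]; [last] recovers the [P0]
     label. There are only countably many addresses. *)
  pose S m := [set w : seq nat | forall y, Y_ (N (last 0%N w)) y ->
    D (N (last 0%N w)) (address_value w) y <= m.+1%:R^-1 -> V y].
  rewrite (_ : _ @^-1` _ = \bigcup_m \bigcup_(w in S m)
      address m.+1 @^-1` [set w]).
    apply: functionally_Fsigma_bigcup => m _.
    by apply: functionally_Fsigma_bigcup => w _; exact: address_Fsigma.
  apply/seteqP; split=> [x /= Vgx|x [m _ [w Sw xw]]]; last first.
    have [Yg Dg] := gP x.
    have {}xw : address m.+1 x = w := xw.
    by apply: Sw; rewrite -xw last_address.
  have [Yg Dg] := gP x.
  have [e e0 eV] := cmo_nbhs (mD _) oV Vgx Yg.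
  have [M /(_ _ (leqnn M)) Me] := inv_nat_small (divr_gt0 e0 (ltr0Sn R 1)).
  exists M => //; exists (address M.+1 x) => // y; rewrite last_address => Yy Dy.
  apply: eV => //; have := Dg M; move: Me Dy.
  have := cmo_triangle (mD (N (P0 x))) (address_value (address M.+1 x)) (g x) y.
  rewrite (cmo_sym (mD _) (g x) (address_value _)).
  by set c := _^-1; lra.
move=> x; have [Yg Dg] := gP (val x).
(* On [E] every piece around [x] takes a value [f z] with [z] in the same piece, close to both [f x]
   and the limit. *)
apply: (cmo_eq (mD _) Yg (fP0 x)); apply/eqP; rewrite eq_le; apply/andP; split.
  apply/ler_addgt0Pr => e e0; rewrite add0r.
  have [M /(_ _ (leqnn M)) Me] := inv_nat_small (divr_gt0 e0 (ltr0Sn R 1)).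
  have [z zx zE] := address_value_trace (erefl (address M.+1 (val x))).
  have := address_trace_close zx (erefl _); have := Dg M; rewrite zE; move: Me.
  have := cmo_triangle (mD (N (P0 (val x)))) (f z) (g (val x)) (f x).
  rewrite (cmo_sym (mD _) (g (val x)) (f z)).
  by set c := _^-1; lra.
(* Nonnegativity of the metric comes from the triangle inequality and symmetry. *)
have := cmo_triangle (mD (N (P0 (val x)))) (f x) (g (val x)) (g (val x)).
by rewrite (cmo_refl (mD _)) (cmo_sym (mD _) (f x)); lra.
Qed.

End extension.

(** * Assembling the partitions *)

Theorem theorem5p5 (R : realType) (X : topologicalType) (E : set X)
    (Y : topologicalType) (Y_ : nat -> set Y)
    (hX1 : accessible_space X) (hXcr : completely_regular_space X)
    (hEB : hereditarily_baire (set_type E))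
    (hEm : metrizable R (set_type E))
    (hEs : separable (set_type E))
    (hY0 : [set: Y] !=set0)
    (hYa : super_sequentially_absorbing Y_)
    (hYm : forall n : nat, completely_metrizable R (set_type (Y_ n))) :
  K1_extension_property R E Y.
Proof.
move=> f Kf.
have [V [cV V_base]] := cozero_trace_base hXcr hEm hEs.
have [U [oU U_base]] := separable_metrizable_base hEm hEs.
have /choice[D mD] : forall n, exists D : Y -> Y -> R, complete_metric_on (Y_ n) D.
  by move=> n; exact: completely_metrizable_on.
have [YT cY _ _] := hYa.
have [y0 _] := hY0; have [n0 _ Yy0] : (\bigcup_n Y_ n) y0 by rewrite YT.
have [|A B AB [n Bn]|F cF F0|P0 P0P] := @good_partition R X E
  (fun S => exists n, S `<=` f @^-1` Y_ n) _ _ V cV V_base.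
- by exists 0%N.
- by exists n; exact: subset_trans Bn.
- exact: (absorbed_piece hEB Kf oU U_base hYa cF F0).
(* The index is enlarged so that [Y_ (N i)] also contains the default value [y0]. *)
have /choice[N NP] : forall i, exists n, Y_ n y0 /\
    set_val @^-1` (P0 @^-1` [set i]) `<=` f @^-1` Y_ n.
  move=> i; have [_ [n fn]] := P0P i; exists (maxn n n0); split.
    exact: absorbing_le hYa (leq_maxr _ _) _ Yy0.
  by move=> x /fn; exact: absorbing_le hYa (leq_maxl _ _) _.
(* One partition of [X] for each metric [D n] and each bound [1/(m+1)]. *)
have /choice[P PP] : forall nm : nat * nat, exists P : X -> nat, forall i,
    functionally_Fsigma R (P @^-1` [set i]) /\
    forall x z, (set_val @^-1` (P @^-1` [set i])) x ->
      (set_val @^-1` (P @^-1` [set i])) z -> Y_ nm.1 (f x) -> Y_ nm.1 (f z) ->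
      D nm.1 (f x) (f z) < nm.2.+1%:R^-1.
  move=> [n m]; apply: (good_partition (good := fun S => forall x z, S x -> S z ->
    Y_ n (f x) -> Y_ n (f z) -> D n (f x) (f z) < m.+1%:R^-1) _ _ cV V_base) => //.
    by move=> A B AB gB x z /AB Bx /AB; exact: gB.
  move=> F cF F0; apply: (small_oscillation_piece hEB Kf oU U_base (mD n)) => //.
  by rewrite invr_gt0 ltr0Sn.
apply: (@K1_extension_of_partitions _ _ _ _ f Y_ D P0 N (fun n m => P (n, m)) y0 mD).
- by move=> i; case: (P0P i).
- by move=> n m i; case: (PP (n, m) i).
- by move=> x; have [_] := NP (P0 (val x)); apply.
- by move=> n m x z xz; have [_ /(_ x z)] := PP (n, m) (P (n, m) (val x)); apply.
- by move=> i; case: (NP i).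
Qed.
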